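(* For every $A>0$ and $p\in(1,2)$ there is a constant $c(A,p)>0$ such that the following holds. Let $\varphi_1,\ldots,\varphi_N$ be an orthonormal system in $L_2(\mathcal X,\mu)$, $\mu(\mathcal X)=1$, that is uniformly bounded: $\|\varphi_k\|_\infty\le A$ for all $k$. Then $$ d_n(\{\varphi_1,\ldots,\varphi_N\},L_p)\ge c(A,p)\quad\text{if } n\le\tfrac12N^{2/p'}, $$ where $p'=p/(p-1)$.
   Context: Functions are real-valued, $L_p=L_p(\mathcal X,\mu)$. The Kolmogorov width is $d_n(K,X)=\inf_{Q_n}\sup_{f\in K}\inf_{g\in Q_n}\|f-g\|_X$, the infimum being over linear subspaces $Q_n\subset X$ of dimension at most $n$. *)

(* Defs.v *)
From HB Require Import structures.
From mathcomp Require Import all_boot all_order all_algebra.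
From mathcomp Require Import all_classical all_reals all_analysis.

Set Implicit Arguments.
Unset Strict Implicit.
Unset Printing Implicit Defensive.

Import Order.TTheory GRing.Theory Num.Theory.
Import numFieldNormedType.Exports.

Local Open Scope classical_set_scope.
Local Open Scope ring_scope.

Definition subspace_dim_le (R : realType) (V : lmodType R) (n : nat)
    (Q : set V) : Prop :=
  submod_closed (mem Q) /\
  exists2 b : 'I_n -> V, (forall i, Q (b i)) &
    forall v, Q v -> exists a : 'I_n -> R, v = \sum_(i < n) a i *: b i.

(* L_p is represented by its functions (the predicate [Lfun mu p]) instead of  *)
(* their a.e. classes, since the library has no linear structure on            *)
(* [LspaceType].  This does not affect the width: choosing representatives of  *)
(* a spanning family lifts a subspace of classes to a subspace of functions    *)
(* spanned by equally many elements, and the norm only depends on the class.   *)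
Definition kolmogorov_width d (T : measurableType d) (R : realType)
    (mu : {measure set T -> \bar R}) (p : \bar R) (n : nat)
    (K : set (T -> R)) : \bar R :=
  ereal_inf [set
      ereal_sup [set
          ereal_inf [set 'N[mu]_p[EFin \o (f \- g)%R]%E | g in Q]
        | f in K]
    | Q in [set Q : set (T -> R) |
        {subset Q <= Lfun mu p} /\ subspace_dim_le n Q]].

Definition orthonormal_system d (T : measurableType d) (R : realType)
    (mu : {measure set T -> \bar R}) (N : nat) (phi : 'I_N -> T -> R) : Prop :=
  (forall k, phi k \in Lfun mu 2%:E) /\
  (forall j k, (\int[mu]_x (phi j x * phi k x)%:E)%E = ((j == k)%:R)%:E).

(* Main.v *)
Require Import Defs.
From HB Require Import structures.
From mathcomp Require Import all_boot all_order all_algebra.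
From mathcomp Require Import all_classical all_reals all_analysis.
From mathcomp Require Import measurable_realfun ess_sup_inf.
From mathcomp Require Import ring lra.

Import Order.TTheory GRing.Theory Num.Theory.
Import numFieldNormedType.Exports.

Local Open Scope classical_set_scope.
Local Open Scope ring_scope.

(** Suppose that every phi k is within c of some g k, in the norm of L_p, where
the g k lie in an n-dimensional space. Let G be the N x N matrix of
coefficients \int g_k phi_j. Its rank is at most n, because the g k are
combinations of n functions ([kolmogorov_width_lt]). On the other hand G is
close to the identity matrix, since \int phi_k phi_j is the Kronecker symbol and
the errors h_k = phi_k - g_k have small coefficients.

Smallness is measured in two ways, with t = (2 - p) / p = 1 - 2 / p'
([orthonormal_coef_le]): each coefficient of h_k is at most c A^t, and the sum
of their squares is at most (c A^t)^2 N^t. Both follow by duality from the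
elementary bound of the L_p' norm of a function by its sup norm and its L_2
norm, applied to one phi j and to the combination of all phi j with the
coefficients of h_k.

For any square matrix (\tr G)^2 <= \rank G * \sum_i \sum_j G_ij^2
([sqr_mxtrace_le_rank]). Here the trace is of order N while the double sum is
at most of order N^(1 + t), so the rank exceeds N^(1 - t) / 2 once c A^t = 1/10
([rank_near_identity_gt]). As 1 - t = 2 / p', this contradicts the assumption
on n. *)

Set Implicit Arguments.
Unset Strict Implicit.

(** * Trace and rank *)

Lemma mxtrace_mul_tr (R : realFieldType) (m n : nat) (G : 'M[R]_(m, n)) :
  \tr (G *m G^T) = \sum_i \sum_j G i j ^+ 2.
Proof.
apply: eq_bigr => i _; rewrite mxE; apply: eq_bigr => j _.
by rewrite mxE expr2.
Qed.

Lemma mxtrace_mul_tr_ge0 (R : realFieldType) (m n : nat) (G : 'M[R]_(m, n)) :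
  0 <= \tr (G *m G^T).
Proof.
by rewrite mxtrace_mul_tr; do 2!apply: sumr_ge0 => ? _; exact: sqr_ge0.
Qed.

Lemma row_free_gram_unit (R : realFieldType) (r N : nat) (B : 'M[R]_(r, N)) :
  row_free B -> B *m B^T \in unitmx.
Proof.
move=> fB; rewrite -row_free_unit -kermx_eq0; apply/eqP/row_matrixP => i.
rewrite row0; set u := row i _.
have uBB : u *m (B *m B^T) = 0 by apply/sub_kermxP; exact: row_sub.
apply/eqP; rewrite -(mulmx_free_eq0 _ fB); apply/eqP/rowP => j.
have := mxtrace_mul_tr (u *m B).
rewrite trmx_mul -mulmxA [B *m _]mulmxA (mulmxA u) uBB mul0mx mxtrace0 big_ord1.
move/esym/eqP; rewrite psumr_eq0 => [/allP/(_ j (mem_index_enum _))|k _].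
  by rewrite /= sqrf_eq0 => /eqP ->; rewrite mxE.
exact: sqr_ge0.
Qed.

(** Cauchy-Schwarz for the Frobenius inner product. If P is the orthogonal
projection onto the row space of G, then G *m P = G, so \tr G is the inner
product of G with P, and the squared norm of P is \tr P = \rank G. *)
Lemma sqr_mxtrace_le_rank (R : realFieldType) (N : nat) (G : 'M[R]_N) :
  (\tr G) ^+ 2 <= (\rank G)%:R * \sum_i \sum_j G i j ^+ 2.
Proof.
rewrite -mxtrace_mul_tr.
have [fB GB] : row_free (row_base G) /\ (G <= row_base G)%MS.
  by rewrite row_base_free eq_row_base.
move: (row_base G) fB GB => B fB /submxP[X GX].
set r := \rank G in B fB X GX *.
pose S := B *m B^T.
have uS : S \in unitmx by exact: row_free_gram_unit.
(* The orthogonal projection onto the span of the rows of B. *)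
pose P := B^T *m invmx S *m B.
have ST : S^T = S by rewrite /S trmx_mul trmxK.
have PT : P^T = P by rewrite /P !trmx_mul trmxK trmx_inv ST mulmxA.
have BP : B *m P = B by rewrite /P !mulmxA mulmxV // mul1mx.
have PP : P *m P = P by rewrite {1}/P -mulmxA BP.
have GP : G *m P = G by rewrite GX -mulmxA BP.
have PG : P *m G^T = G^T by rewrite -{1}PT -trmx_mul GP.
have trP : \tr P = r%:R by rewrite /P mxtrace_mulC mulmxA mulmxV // mxtrace1.
have [r0|r0] := posnP r.
  have -> : G = 0 by apply/eqP; rewrite -mxrank_eq0 -/r r0.
  by rewrite mxtrace0 mul0mx mxtrace0 mulr0 expr0n.
have r0' : 0 < r%:R :> R by rewrite ltr0n.
rewrite -subr_ge0 -(pmulr_rge0 _ r0').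
(* Cauchy-Schwarz as the nonnegativity of the squared norm of G minus its
   component along P, rescaled by r to avoid a division. *)
have := mxtrace_mul_tr_ge0 (r%:R *: G - \tr G *: P).
rewrite [(_ - _)^T]linearB /= ![(_ *: _)^T]linearZ /= PT.
rewrite mulmxBl !mulmxBr -!scalemxAl -!scalemxAr.
have trB (U V : 'M[R]_N) : \tr (U - V) = \tr U - \tr V by rewrite raddfB.
rewrite GP PG PP !trB !mxtraceZ mxtrace_tr trP.
set a := \tr (G *m _); set b := \tr G; set c := _%:R => h.
apply: le_trans h _; lra.
Qed.

(** The trace of 1%:M - H is at least 9/10 N, since only the diagonal of H
enters it, while the squared Frobenius norm is at most 121/100 D N. The
inequality between trace and rank then bounds the rank below by a multiple of
N / D. The constant 10^-1 only has to be small enough for the resulting factor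
(9/10)^2 / (121/100) to exceed 1/2. *)
Lemma rank_near_identity_gt (R : realFieldType) (N : nat) (H : 'M[R]_N)
    (D : R) :
    (0 < N)%N -> 1 <= D ->
    (forall k, `|H k k| <= 10^-1) ->
    (forall k, \sum_j H k j ^+ 2 <= 10^-1 ^+ 2 * D) ->
  N%:R < 2 * D * (\rank (1%:M - H))%:R.
Proof.
move=> N0 D1 Hdiag Hrow; have N0' : 0 < N%:R :> R by rewrite ltr0n.
set G := 1%:M - H; set r : R := (\rank G)%:R.
have trG : 9 / 10 * N%:R <= \tr G.
  have -> : 9 / 10 * N%:R = \sum_(k < N) 9 / 10 :> R.
    by rewrite sumr_const card_ord mulr_natr.
  apply: ler_sum => k _; rewrite !mxE eqxx mulr1n.
  have := ler_norm (H k k); have := Hdiag k; lra.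
have frobG : \sum_k \sum_j G k j ^+ 2 <= 121 / 100 * D * N%:R.
  have -> : 121 / 100 * D * N%:R = \sum_(k < N) 121 / 100 * D :> R.
    by rewrite sumr_const card_ord mulr_natr.
  apply: ler_sum => k _.
  have -> : \sum_j G k j ^+ 2 = \sum_j H k j ^+ 2 + (1 - 2 * H k k).
    rewrite (bigD1 k)//= [in RHS](bigD1 k)//= addrAC; congr +%R.
      by rewrite !mxE eqxx mulr1n; ring.
    apply: eq_bigr => j /negPf jk.
    by rewrite !mxE eq_sym jk mulr0n sub0r sqrrN.
  have := Hrow k; have := Hdiag k; have := ler_norm (- H k k).
  rewrite normrN; nra.
have trG2 : (9 / 10 * N%:R) ^+ 2 <= \tr G ^+ 2 by rewrite lerXn2r ?nnegrE; nra.
have r0 : 0 <= r by rewrite ler0n.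
have := le_trans trG2 (sqr_mxtrace_le_rank G).
move=> /le_trans/(_ (ler_wpM2l r0 frobG)) h.
have {h}: 81 / 100 * N%:R <= 121 / 100 * D * r.
  by rewrite -(ler_pM2r N0'); apply: le_trans (le_trans h _); rewrite -/r; lra.
nra.
Qed.

(** * Norms of bounded functions and duality *)

Lemma Lfun_measurable d (T : measurableType d) (R : realType)
    (mu : {measure set T -> \bar R}) (p : \bar R) (f : T -> R) :
  f \in Lfun mu p -> measurable_fun setT f.
Proof. by move=> /sub_Lfun_mfun; rewrite inE. Qed.

(** Integrate `|F|^q <= M^(q-2) F^2. *)
Lemma Lnorm_le_bounded d (T : measurableType d) (R : realType)
    (mu : {measure set T -> \bar R}) (F : T -> R) (M s q : R) :
    2 <= q -> measurable_fun setT F -> 0 <= M -> 0 <= s ->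
    {ae mu, forall x, `|F x| <= M} ->
    (\int[mu]_x (F x * F x)%:E <= s%:E)%E ->
  ('N[mu]_q%:E[EFin \o F] <= (M `^ (1 - 2 / q) * s `^ q^-1)%:E)%E.
Proof.
move=> q2 mF M0 s0 FM Fs.
have q0 : 0 < q by lra.
have -> : M `^ (1 - 2 / q) * s `^ q^-1 = (M `^ (q - 2) * s) `^ q^-1.
  rewrite powRM ?powR_ge0// -powRrM mulrBl divff ?gt_eqF//.
rewrite unlock -poweR_EFin gt0_ler_poweR ?invr_ge0 ?(ltW q0)//.
- by rewrite in_itv/= leey integral_ge0.
- by rewrite in_itv/= leey lee_fin mulr_ge0 ?powR_ge0.
rewrite EFinM; apply: le_trans; last first.
  by apply: lee_wpmul2l Fs; rewrite lee_fin powR_ge0.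
rewrite -ge0_integralZl//; last 3 first.
- by apply/measurable_EFinP; exact: measurable_funM.
- by move=> x _; rewrite lee_fin -expr2 sqr_ge0.
- by rewrite lee_fin powR_ge0.
apply: ae_ge0_le_integral => //.
- by move=> x _; exact: poweR_ge0.
- apply/measurable_EFinP.
  by apply/(@measurableT_comp _ _ _ _ _ _ (@powR R ^~ q))/measurableT_comp.
- by move=> x _; rewrite mule_ge0// lee_fin ?powR_ge0// -expr2 sqr_ge0.
- apply/measurable_EFinP; apply: measurable_funM => //.
  exact: measurable_funM.
apply: filterS FM => x FxM _.
rewrite -EFinM lee_fin.
rewrite -expr2 -(real_normK (num_real (F x))) -powR_mulrn//=.
rewrite -[in leLHS](subrK 2 q).
have [->|Fx0] := eqVneq `|F x| 0.
  by rewrite powR0 ?subrK ?gt_eqF// mulr_ge0 ?powR_ge0.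
rewrite [in leLHS]powRD ?Fx0 ?implybT// ler_wpM2r ?powR_ge0//.
by rewrite ge0_ler_powR ?nnegrE// subr_ge0.
Qed.

(** Hoelder's inequality with q = p / (p - 1), followed by [Lnorm_le_bounded]:
1 - 2 / q = (2 - p) / p and q^-1 = (p - 1) / p. *)
Lemma hoelder_bounded d (T : measurableType d) (R : realType)
    (mu : {measure set T -> \bar R}) (f F : T -> R) (e M s p : R) :
    1 < p < 2 -> f \in Lfun mu p%:E -> ('N[mu]_p%:E[EFin \o f] <= e%:E)%E ->
    measurable_fun setT F -> 0 <= M -> 0 <= s ->
    {ae mu, forall x, `|F x| <= M} ->
    (\int[mu]_x (F x * F x)%:E <= s%:E)%E ->
  mu.-integrable setT (EFin \o (f \* F)) /\
  `|\int[mu]_x (f x * F x)| <= e * (M `^ ((2 - p) / p) * s `^ ((p - 1) / p)).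
Proof.
move=> /andP[p1 p2] fp fe mF M0 s0 FM Fs.
have mf := Lfun_measurable fp.
pose q := p / (p - 1).
have p0 : 0 < p by lra.
have q0 : 0 < q by rewrite divr_gt0// subr_gt0.
have q2 : 2 <= q by rewrite ler_pdivlMr ?subr_gt0//; lra.
have qV : q^-1 = (p - 1) / p by rewrite invf_div.
have N1 : ('N[mu]_1[EFin \o (f \* F)%R] <=
    (e * (M `^ ((2 - p) / p) * s `^ ((p - 1) / p)))%:E)%E.
  apply: le_trans (hoelder mu mf mF p0 q0 _) _.
    by rewrite qV mulrBl divff ?gt_eqF// mul1r subrKC.
  rewrite [leRHS]EFinM; apply: lee_pmul => //; rewrite ?Lnorm_ge0//.
  have -> : (2 - p) / p = 1 - 2 / q.
    by rewrite qV; field; rewrite gt_eqF.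
  by rewrite -qV; exact: Lnorm_le_bounded.
have int : mu.-integrable setT (EFin \o (f \* F)).
  apply/Lfun1_integrable; rewrite inE; apply/andP; split; rewrite inE/=.
    exact: measurable_funM.
  by rewrite /finite_norm (le_lt_trans N1)// ltry.
split=> //; rewrite -lee_fin EFin_normr_Rintegral//.
apply: le_trans (le_abse_integral _ _ _) _ => //.
  exact/measurable_EFinP/measurable_funM.
by rewrite -Lnorm1.
Qed.

Lemma Rintegral_mul_sum d (T : measurableType d) (R : realType)
    (mu : {measure set T -> \bar R}) (n : nat) (h : T -> R)
    (psi : 'I_n -> T -> R) (a : 'I_n -> R) :
    (forall i, mu.-integrable setT (EFin \o (h \* psi i))) ->
  mu.-integrable setT (EFin \o (h \* (fun x => \sum_i a i * psi i x))) /\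
  \int[mu]_x (h x * \sum_i a i * psi i x) =
  \sum_i a i * \int[mu]_x (h x * psi i x).
Proof.
move=> hpsi.
have E : EFin \o (h \* (fun x => \sum_i a i * psi i x))%R =
    (fun x => \sum_i (a i)%:E * (h x * psi i x)%:E)%E.
  apply/funext => x /=; rewrite mulr_sumr -sumEFin.
  by apply: eq_bigr => i _; rewrite mulrCA EFinM.
have ahpsi i : mu.-integrable setT (fun x => (a i)%:E * (h x * psi i x)%:E)%E.
  exact: integrableZl (hpsi i).
split; first by rewrite E; exact: integrable_sum.
rewrite /Rintegral -[X in integral _ _ X]/(EFin \o (h \* _)%R) E integral_sum//.
rewrite -[RHS]/(fine (\sum_i a i * \int[mu]_x (h x * psi i x))%:E) -sumEFin.
congr fine; apply: eq_bigr => i _.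
rewrite integralZl//; last exact: hpsi.
by rewrite EFinM fineK//; exact: (integrable_fin_num _ (hpsi i)).
Qed.

(** * Coefficients with respect to a bounded orthonormal system *)

Lemma sqr_sum_le (R : realFieldType) (N : nat) (c : 'I_N -> R) :
  (\sum_k c k) ^+ 2 <= N%:R * \sum_k c k ^+ 2.
Proof.
have [N0|N0] := posnP N; first by subst N; rewrite !big_ord0 expr0n mulr0.
have N0' : 0 < N%:R :> R by rewrite ltr0n.
rewrite -subr_ge0 -(pmulr_rge0 _ N0').
set X := \sum_k c k; set S := \sum_k _ ^+ 2.
have -> : N%:R * (N%:R * S - X ^+ 2) = \sum_k (N%:R * c k - X) ^+ 2.
  have sqE k : (N%:R * c k - X) ^+ 2 =
      N%:R ^+ 2 * c k ^+ 2 + (- 2 * N%:R * X) * c k + X ^+ 2 by ring.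
  rewrite (eq_bigr _ (fun k _ => sqE k)) !big_split/= -!mulr_sumr -/X -/S.
  rewrite sumr_const card_ord; ring.
by apply: sumr_ge0 => k _; exact: sqr_ge0.
Qed.

Lemma orthonormal_combination d (T : measurableType d) (R : realType)
    (mu : {measure set T -> \bar R}) (N : nat) (phi : 'I_N -> T -> R)
    (c : 'I_N -> R) (S := \sum_k c k ^+ 2)
    (F := fun x => \sum_k c k * phi k x) :
    orthonormal_system mu phi ->
  (\int[mu]_x (F x * F x)%:E = S%:E)%E.
Proof.
move=> [phi2 phiO].
have intphi j k : mu.-integrable setT (EFin \o (phi j \* phi k)).
  exact/Lfun1_integrable/Lfun2_mul_Lfun1.
have phiF j := Rintegral_mul_sum c (intphi j).
have FphiE j : (F \* phi j) = (phi j \* F) :> (T -> R).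
  by apply/funext => x /=; rewrite mulrC.
have intF j : mu.-integrable setT (EFin \o (F \* phi j)).
  by rewrite FphiE; exact: (phiF j).1.
have [intFF FF] := Rintegral_mul_sum c intF.
rewrite -[LHS]fineK; last exact: (integrable_fin_num _ intFF).
congr EFin; apply: etrans FF _; apply: eq_bigr => j _; rewrite expr2; congr *%R.
rewrite -[X in Rintegral _ _ X]/(F \* phi j) FphiE (phiF j).2.
rewrite (bigD1 j)//= big1 ?addr0.
  by rewrite /Rintegral phiO eqxx mulr1.
by move=> i ij; rewrite /Rintegral phiO eq_sym (negPf ij) mulr0.
Qed.

Lemma ae_combination_le d (T : measurableType d) (R : realType)
    (mu : {measure set T -> \bar R}) (A : R) (N : nat) (phi : 'I_N -> T -> R)
    (c : 'I_N -> R) :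
    0 <= A -> (forall k, {ae mu, forall x, `|phi k x| <= A}) ->
  {ae mu, forall x, `|\sum_k c k * phi k x| <=
    A * (Num.sqrt N%:R * Num.sqrt (\sum_k c k ^+ 2))}.
Proof.
move=> A0 phiA.
have : {ae mu, forall x, forall k, `|phi k x| <= A} by exact: filter_forall.
apply: filterS => x phixA.
have S0 : 0 <= \sum_k c k ^+ 2 by apply: sumr_ge0 => k _; exact: sqr_ge0.
apply: (@le_trans _ _ (\sum_k `|c k| * A)).
  apply: le_trans (ler_norm_sum _ _ _) _.
  by apply: ler_sum => k _; rewrite normrM ler_wpM2l.
rewrite -mulr_suml mulrC ler_wpM2l// -sqrtrM ?ler0n//.
rewrite -[leLHS]ger0_norm ?sumr_ge0// -sqrtr_sqr ler_wsqrtr//.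
under [X in _ * X]eq_bigr => k _ do rewrite -real_normK ?num_real//.
exact: sqr_sum_le.
Qed.

(** The sum of squares bound is the l_2 form of the Hausdorff-Young inequality of
F. Riesz: for N coefficients, passing from l_p' to l_2 costs N^(t / 2) with
t = (2 - p) / p. It follows directly by duality. The function
F = \sum_k c k * phi k satisfies \int f F = \int F^2 = S, the sum of the squared
coefficients, and `|F| <= A sqrt N sqrt S almost everywhere. Pairing f with F
in [hoelder_bounded] gives S <= e (A sqrt N)^t sqrt S, the exponents of S
adding up to t / 2 + (p - 1) / p = 1 / 2. Pairing f with a single phi k bounds
each coefficient independently of N. *)
Lemma orthonormal_coef_le d (T : measurableType d) (R : realType)
    (mu : {measure set T -> \bar R}) (A p e : R) (N : nat)
    (phi : 'I_N -> T -> R) (f : T -> R)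
    (c := fun k => \int[mu]_x (f x * phi k x)) :
    1 < p < 2 -> 0 <= A -> orthonormal_system mu phi ->
    (forall k, {ae mu, forall x, `|phi k x| <= A}) ->
    f \in Lfun mu p%:E -> ('N[mu]_p%:E[EFin \o f] <= e%:E)%E ->
  [/\ forall k, mu.-integrable setT (EFin \o (f \* phi k)),
      forall k, `|c k| <= e * A `^ ((2 - p) / p) &
      \sum_k c k ^+ 2 <= (e * A `^ ((2 - p) / p)) ^+ 2 * N%:R `^ ((2 - p) / p)].
Proof.
move=> p12 A0 Ophi phiA fp fe; have [phi2 phiO] := Ophi.
have mphi k := Lfun_measurable (phi2 k).
have coef k : mu.-integrable setT (EFin \o (f \* phi k)) /\
    `|c k| <= e * A `^ ((2 - p) / p).
  have := hoelder_bounded p12 fp fe (mphi k) A0 ler01 (phiA k).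
  by rewrite phiO eqxx powR1 mulr1; apply.
have e0 : 0 <= e by rewrite -lee_fin; apply: le_trans fe; exact: Lnorm_ge0.
split=> [k|k|]; [exact: (coef k).1|exact: (coef k).2|].
set S := \sum_k _; set t := (2 - p) / p.
have S0 : 0 <= S by apply: sumr_ge0 => k _; exact: sqr_ge0.
pose F x := \sum_k c k * phi k x.
have mF : measurable_fun setT F.
  by apply: measurable_sum => k; exact: measurable_funM.
have fF : \int[mu]_x (f x * F x) = S.
  exact: (Rintegral_mul_sum c (fun k => (coef k).1)).2.
pose v : R := Num.sqrt N%:R; pose w := Num.sqrt S.
have vt : (v `^ t) ^+ 2 = N%:R `^ t.
  by rewrite expr2 -powRM ?sqrtr_ge0// -expr2 sqr_sqrtr.
have S_w : S = w ^+ 2 by rewrite sqr_sqrtr.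
have w0 : 0 <= w by exact: sqrtr_ge0.
have v0 : 0 <= v by exact: sqrtr_ge0.
have S_le : S <= e * ((A * (v * w)) `^ t * S `^ ((p - 1) / p)).
  rewrite -[leLHS]ger0_norm// -[in leLHS]fF.
  have := @hoelder_bounded _ _ _ _ _ _ _ (A * (v * w)) S _ p12 fp fe mF.
  case=> //; first by rewrite !mulr_ge0.
    exact: ae_combination_le.
  by rewrite orthonormal_combination.
have w_le : w <= e * A `^ t * v `^ t.
  have [->|wN0] := eqVneq w 0; first by rewrite !mulr_ge0 ?powR_ge0.
  have wgt0 : 0 < w by rewrite lt_neqAle eq_sym wN0.
  rewrite -(ler_pM2r wgt0) -expr2 -S_w; apply: le_trans S_le _.
  rewrite !powRM ?mulr_ge0// -!mulrA ler_wpM2l// ler_wpM2l ?powR_ge0//.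
  rewrite ler_wpM2l ?powR_ge0// S_w expr2 powRM// -!powRD ?wN0 ?implybT//.
  rewrite (_ : t + _ = 1) ?powRr1// /t; field.
  by apply/negP => /eqP p0; move: p12; lra.
rewrite -vt -exprMn [in leLHS]S_w lerXn2r// nnegrE.
by rewrite !mulr_ge0 ?powR_ge0.
Qed.

(** * Widths *)

(** Unfolds a small width into approximants written out on a spanning family,
the form in which they yield a matrix factorization. Membership of the
approximants in L_p is kept, as the coefficients need it. *)
Lemma kolmogorov_width_lt d (T : measurableType d) (R : realType)
    (mu : {measure set T -> \bar R}) (p c : \bar R) (n : nat)
    (I : Type) (phi : I -> T -> R) :
    (kolmogorov_width mu p n (range phi) < c)%E ->
  exists (b : 'I_n -> T -> R) (a : I -> 'I_n -> R)
      (g := fun k x => \sum_i a k i * b i x),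
    [/\ forall i, b i \in Lfun mu p, forall k, g k \in Lfun mu p &
      forall k, ('N[mu]_p[EFin \o (phi k \- g k)%R] < c)%E].
Proof.
move=> /ereal_inf_ltP[_ [Q [QL [_ [b Qb Qspan]]] <-] sup_lt].
have near_phi k : exists a : 'I_n -> R,
    let g x := \sum_i a i * b i x in
    g \in Lfun mu p /\ ('N[mu]_p[EFin \o (phi k \- g)%R] < c)%E.
  have /ereal_inf_ltP[_ [g Qg <-] g_lt] := le_lt_trans
    (ereal_sup_ubound (ex_intro2 _ _ _ (imageP phi (Logic.I : setT k)) erefl))
    sup_lt.
  have [a ag] := Qspan g Qg; exists a => /=.
  have -> : (fun x => \sum_i a i * b i x) = g.
    by apply/funext => x; rewrite ag fct_sumE.
  by split=> //; apply/QL/mem_set.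
have [a aP] := choice near_phi.
exists b, a; split=> [i|k|k]; first exact/QL/mem_set.
  exact: (aP k).1.
exact: (aP k).2.
Qed.

Lemma ae_le_Linfty d (T : measurableType d) (R : realType)
    (mu : probability T R) (A : R) (f : T -> R) :
  ('N[mu]_(+oo)[EFin \o f] <= A%:E)%E -> {ae mu, forall x, `|f x| <= A}.
Proof.
have mu0 : (0 < mu setT)%E by rewrite probability_setT.
rewrite unlock /Lnorm mu0 => /ess_supP.
by apply: filterS => x; rewrite /= lee_fin.
Qed.

Unset Implicit Arguments.
Set Strict Implicit.

Theorem corollary4p1 (R : realType) (A p : R) (hA : 0 < A)
    (hp : 1 < p < 2) :
  exists2 c : R, 0 < c &
    forall (d : measure_display) (T : measurableType d)
      (mu : probability T R) (N : nat) (phi : 'I_N -> T -> R),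
      (0 < N)%N ->
      orthonormal_system mu phi ->
      (forall k, ('N[mu]_(+oo)[EFin \o phi k] <= A%:E)%E) ->
      forall n : nat,
        n%:R <= 2^-1 * N%:R `^ (2 / (p / (p - 1))) ->
        (c%:E <= kolmogorov_width mu p%:E n (range phi))%E.
Proof.
have [p1 p2] := andP hp; have p0 : 0 < p by lra.
pose t : R := (2 - p) / p.
have At0 : 0 < A `^ t by rewrite powR_gt0.
(* With this c, a function of norm c has coefficients at most 10^-1, which is
   the threshold of [rank_near_identity_gt]. *)
exists (10^-1 / A `^ t); first by rewrite divr_gt0.
set c := 10^-1 / A `^ t.
have cAt : c * A `^ t = 10^-1 by rewrite /c divfK ?gt_eqF.
move=> d T mu N phi N0 Ophi phiA n n_le.
rewrite leNgt; apply/negP => /kolmogorov_width_lt[b [a [bp gp near_phi]]].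
pose g k x := \sum_i a k i * b i x.
have {}phiA k : {ae mu, forall x, `|phi k x| <= A} by exact: ae_le_Linfty.
have [phi2 phiO] := Ophi.
have p1E : (1 <= p%:E)%E by rewrite lee_fin ltW.
have phip k : phi k \in Lfun mu p%:E.
  apply: Lfun_subset (phi2 k) => //.
  - by rewrite lee_fin; lra.
  - exact: fin_num_measure.
  - by rewrite lee_fin ltW.
have intphi f k : f \in Lfun mu p%:E ->
    mu.-integrable setT (EFin \o (phi k \* f)).
  move=> fp; rewrite (_ : _ \* f = f \* phi k); last first.
    by apply/funext => x /=; rewrite mulrC.
  have := sub_Lfun_finLfun fp; rewrite inE /= /finite_norm => fy.
  have fE : ('N[mu]_p%:E[EFin \o f] <= (fine 'N[mu]_p%:E[EFin \o f])%:E)%E.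
    by rewrite fineK// ge0_fin_numE// Lnorm_ge0.
  by have [+ _ _] := orthonormal_coef_le hp (ltW hA) Ophi phiA fp fE.
pose h k := phi k \- g k.
have hLp k : h k \in Lfun mu p%:E.
  have [_ lin] := Lfun_submod_closed mu p1E.
  have -> : h k = (-1) *: g k + phi k by rewrite scaleN1r addrC.
  exact: (lin (-1) _ _ (gp k) (phip k)).
have coef k := orthonormal_coef_le hp (ltW hA) Ophi phiA
  (hLp k) (ltW (near_phi k)).
(* By orthonormality the coefficients of the g k form the matrix 1%:M - H. *)
pose H : 'M[R]_N := \matrix_(k, j) \int[mu]_x (h k x * phi j x).
(* The g k lie in the span of n functions, which gives the rank bound. *)
have factor : 1%:M - H = (\matrix_(k, i) a k i) *m
    (\matrix_(i, j) \int[mu]_x (phi j x * b i x)).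
  apply/matrixP => k j; rewrite !mxE.
  under [RHS]eq_bigr do rewrite !mxE.
  have [_ <-] := Rintegral_mul_sum (a k)
    (fun i => intphi _ j (bp i)).
  under eq_Rintegral do rewrite /= mulrBl [g k _ * _]mulrC.
  rewrite RintegralB//; last 2 first.
  - exact: intphi.
  - exact: (intphi (g k) j (gp k)).
  by rewrite {1}/Rintegral phiO /= opprB subrKC.
have rankH : (\rank (1%:M - H)%R <= n)%N.
  by rewrite factor (leq_trans (mxrankM_maxr _ _))// rank_leq_row.
have Nge1 : 1 <= N%:R :> R by rewrite ler1n.
have Nt1 : 1 <= N%:R `^ t.
  apply: (@le_trans _ _ (1 `^ t)); first by rewrite powR1.
  by rewrite ge0_ler_powR ?nnegrE// /t divr_ge0//; lra.
have : N%:R < 2 * N%:R `^ t * (\rank (1%:M - H))%:R :> R.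
  apply: rank_near_identity_gt => // k.
    by rewrite mxE -cAt; have [_ + _] := coef k; apply.
  under eq_bigr do rewrite mxE.
  by rewrite -cAt; have [] := coef k.
apply/negP; rewrite -leNgt.
have n_rank : (\rank (1%:M - H))%:R <= n%:R :> R by rewrite ler_nat.
apply: (@le_trans _ _ (2 * N%:R `^ t * (2^-1 * N%:R `^ (2 / (p / (p - 1)))))).
  by rewrite ler_wpM2l ?mulr_ge0 ?powR_ge0// (le_trans n_rank).
rewrite mulrACA divff// mul1r -powRD; last first.
  by rewrite pnatr_eq0 -lt0n N0 implybT.
rewrite (_ : t + _ = 1) ?powRr1// /t; field.
by apply/andP; split; apply/negP => /eqP; lra.
Qed.
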